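(* Let $\nu$ be a tail invariant Borel probability measure on the path-space $X_B$ of a generalized Bratteli diagram $B=(V,E)$. Then there exists a sequence of Markov matrices $(P_n)$ such that $\nu=m(P_n)$, i.e. $\nu$ is the Markov measure generated by $(P_n)$ (together with a suitable initial vector $q$ on $V_0$).
   Context: A generalized Bratteli diagram $B=(V,E)$ is a graded graph with $V=\bigsqcup_{n\ge0}V_n$, each $V_n$ being a copy of a fixed countably infinite set $V_0$, and $E=\bigsqcup_{n\ge 0}E_n$, where $E_n$ is the set of edges between $V_n$ and $V_{n+1}$. Each $e\in E_n$ has a source $s(e)\in V_n$ and a range $r(e)\in V_{n+1}$. For $w\in V_n$, $v\in V_{n+1}$ the set $E(w,v)$ of edges with source $w$ and range $v$ is finite (possibly empty), and $f^{(n)}_{vw}=|E(w,v)|$. The incidence matrix $F_n=(f^{(n)}_{vw}: v\in V_{n+1}, w\in V_n)$ has only finitely many non-zero entries in each row and has no zero row and no zero column. The path-space $X_B$ is the set of infinite paths $x=(x_i)_{i\ge0}$, $x_i\in E_i$, $r(x_i)=s(x_{i+1})$, with the topology whose base consists of the cylinder sets $[\overline e]=\{x\in X_B: x_0=e_0,\dots,x_n=e_n\}$, $\overline e=(e_0,\dots,e_n)$ a finite path. A Borel measure $\mu$ on $X_B$ is tail invariant if $\mu([\overline e])=\mu([\overline e'])$ for any two finite paths $\overline e,\overline e'$ starting in $V_0$ with the same terminal vertex (at the same level). Markov measures: let $q=(q_v)_{v\in V_0}$ be a strictly positive vector and let $P_n=(p^{(n)}_{v,e}: v\in V_n, e\in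 E_n)$, $n\ge 0$, be non-negative matrices (called Markov matrices) with $p^{(n)}_{v,e}>0\iff s(e)=v$ and $\sum_{e:\,s(e)=v}p^{(n)}_{v,e}=1$. The Markov measure $m=m(P_n)$ is the Borel measure on $X_B$ determined by $m([\overline e])=q_{s(e_0)}p^{(0)}_{s(e_0),e_0}\cdots p^{(n)}_{s(e_n),e_n}$ for $\overline e=(e_0,\dots,e_n)$, $s(e_0)\in V_0$.
   Formalization: Strict positivity of q and of p_{v,e} for s(e)=v fails for measures not of full support (e.g. a Dirac mass when each vertex has one edge v→v), so q and P_n may have zeros there in general; the strict form is proved whenever ν has full support. *)

(* Defs.v *)
From HB Require Import structures.
From mathcomp Require Import all_boot all_order all_algebra finmap.
From mathcomp Require Import all_classical all_reals all_analysis.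
Set Implicit Arguments.
Unset Strict Implicit.
Unset Printing Implicit Defensive.
Import Order.TTheory GRing.Theory Num.Theory.
Local Open Scope classical_set_scope.
Local Open Scope ring_scope.

(* Each level V_n is a copy of V_0, so one type [vertex] carries all of them:
   [edge n] is E_n, whose sources live in V_n and ranges in V_(n+1). *)
Record graded_graph := GradedGraph {
  vertex : countType;
  edge : nat -> choiceType;
  src : forall n, edge n -> vertex;
  rng : forall n, edge n -> vertex
}.

Definition edges_between (G : graded_graph) n (w v : vertex G) :
    set (edge G n) :=
  [set e | src e = w /\ rng e = v].
Arguments edges_between {G} n w v.

(* f^(n)_(vw), rows indexed by V_(n+1) and columns by V_n; [fset_set] is junk
   on infinite sets, which [edges_finite] below rules out. *)
Definition incidence (G : graded_graph) n (v w : vertex G) : nat :=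
  #|` fset_set (edges_between n w v)|.

Record gen_bratteli := GenBratteli {
  gb_graph :> graded_graph;
  vertex_infinite : infinite_set [set: vertex gb_graph];
  edges_finite : forall n (w v : vertex gb_graph),
    finite_set (edges_between n w v);
  incidence_row_finite : forall n (v : vertex gb_graph),
    finite_set [set w | incidence n v w <> 0%N];
  incidence_row_neq0 : forall n (v : vertex gb_graph),
    exists w, incidence n v w <> 0%N;
  incidence_col_neq0 : forall n (w : vertex gb_graph),
    exists v, incidence n v w <> 0%N
}.

Record path_space (B : gen_bratteli) := InfPath {
  path_edge :> forall i, edge B i;
  path_edgeP : forall i, rng (path_edge i) = src (path_edge i.+1)
}.

(* A finite path (e_0, ..., e_n), so with n.+1 edges, starting in V_0. *)
Record fin_path (B : gen_bratteli) (n : nat) := FinPath {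
  fpath_edge :> forall i : 'I_n.+1, edge B i;
  fpath_edgeP : forall i : 'I_n,
    rng (fpath_edge (widen_ord (leqnSn n) i)) = src (fpath_edge (lift ord0 i))
}.

Definition fpath_start (B : gen_bratteli) n (e : fin_path B n) : vertex B :=
  src (e ord0).

Definition fpath_end (B : gen_bratteli) n (e : fin_path B n) : vertex B :=
  rng (e ord_max).

Definition cylinder (B : gen_bratteli) n (e : fin_path B n) :
    set (path_space B) :=
  [set x : path_space B | forall i : 'I_n.+1, x i = e i].

Definition cylinders (B : gen_bratteli) : set (set (path_space B)) :=
  [set C | exists n (e : fin_path B n), C = cylinder e].

Lemma src_surj (B : gen_bratteli) n (w : vertex B) :
  exists e : edge B n, src e = w.
Proof.
have [v fvw] := incidence_col_neq0 n w.
have [E0|/set0P[e [sew _]]] := eqVneq (edges_between n w v) set0.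
  by case: fvw; rewrite /incidence E0 fset_set0 cardfs0.
by exists e.
Qed.

Lemma path_space_inhabited (B : gen_bratteli) : exists x : path_space B, True.
Proof.
have [v0 _] : exists v : vertex B, True.
  have /set0P[v _] : [set: vertex B] != set0.
    by apply/eqP => V0; apply: (@vertex_infinite B); rewrite V0.
  by exists v.
pose next n (v : vertex B) := projT1 (cid (src_surj n v)).
have nextE n v : src (next n v) = v by rewrite /next; case: cid.
pose vs := fix vs n := if n is m.+1 then rng (next m (vs m)) else v0.
by exists (@InfPath B (fun n => next n (vs n)) (fun i => esym (nextE _ _))).
Qed.

Definition path_prefix (B : gen_bratteli) (x : path_space B) n :
    fin_path B n :=
  @FinPath B n (fun i : 'I_n.+1 => x i) (fun i : 'I_n => path_edgeP x i).

Lemma cylinders_cover (B : gen_bratteli) :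
  \bigcup_(C in @cylinders B) idfun C = setT.
Proof.
rewrite -subTset => x _; exists (cylinder (path_prefix x 0)) => //.
by exists 0%N, (path_prefix x 0).
Qed.

Lemma cylinders_join (B : gen_bratteli) (C D : set (path_space B)) x :
  cylinders C -> cylinders D -> idfun C x -> idfun D x ->
  exists K, [/\ cylinders K, idfun K x & idfun K `<=` idfun C `&` idfun D].
Proof.
move=> [n [e ->]] [m [e' ->]] /= xe xe'.
exists (cylinder (path_prefix x (maxn n m))); split => //.
  by exists (maxn n m), (path_prefix x (maxn n m)).
move=> y yx; split=> i.
  have il : (i < (maxn n m).+1)%N by rewrite (leq_trans (ltn_ord i))// ltnS leq_maxl.
  by rewrite -xe; exact: (yx (Ordinal il)).
have il : (i < (maxn n m).+1)%N by rewrite (leq_trans (ltn_ord i))// ltnS leq_maxr.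
by rewrite -xe'; exact: (yx (Ordinal il)).
Qed.

HB.instance Definition _ (B : gen_bratteli) := gen_eqMixin (path_space B).
HB.instance Definition _ (B : gen_bratteli) := gen_choiceMixin (path_space B).
HB.instance Definition _ (B : gen_bratteli) :=
  isPointed.Build (path_space B) (projT1 (cid (path_space_inhabited B))).
HB.instance Definition _ (B : gen_bratteli) :=
  @isBaseTopological.Build (path_space B) (set (path_space B)) (@cylinders B)
    idfun (@cylinders_cover B) (@cylinders_join B).

Definition borel_path_space (B : gen_bratteli) :=
  g_sigma_algebraType (@open (path_space B)).

Definition tail_invariant (R : realType) (B : gen_bratteli)
    (mu : {measure set (borel_path_space B) -> \bar R}) :=
  forall n (e e' : fin_path B n),
    fpath_end e = fpath_end e' -> mu (cylinder e) = mu (cylinder e').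

Definition full_support (R : realType) (B : gen_bratteli)
    (mu : {measure set (borel_path_space B) -> \bar R}) :=
  forall U : set (path_space B), open U -> U !=set0 -> (0 < mu U)%E.

Definition markov_matrix (R : realType) (B : gen_bratteli) n
    (p : vertex B -> edge B n -> R) :=
  [/\ forall v e, 0 <= p v e,
      forall v e, 0 < p v e <-> src e = v &
      forall v, \esum_(e in [set e | src e = v]) (p v e)%:E = 1%E].

(* Vanishing transition probabilities are allowed. Strict positivity of q and
   of the p^(n)_(v,e) with s(e) = v makes every cylinder set non-null, so a
   measure that is not of full support can only have this kind of matrices. *)
Definition weak_markov_matrix (R : realType) (B : gen_bratteli) n
    (p : vertex B -> edge B n -> R) :=
  [/\ forall v e, 0 <= p v e,
      forall v e, 0 < p v e -> src e = v &
      forall v, \esum_(e in [set e | src e = v]) (p v e)%:E = 1%E].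

Definition is_markov_measure (R : realType) (B : gen_bratteli)
    (q : vertex B -> R) (P : forall n, vertex B -> edge B n -> R)
    (mu : {measure set (borel_path_space B) -> \bar R}) :=
  forall n (e : fin_path B n),
    mu (cylinder e) =
    (q (fpath_start e) * \prod_(i < n.+1) P i (src (e i)) (e i))%:E.

(* Main.v *)
(* By tail invariance, the measure of the cylinder of a finite path from V_0
   depends only on its terminal vertex; let a_n(v) be this mass for v in V_n,
   with a_0(v) the measure of the set of paths starting at v.  Splitting a
   cylinder ending at v along the countably many edges e leaving v gives
   a_n(v) = \sum_e a_(n+1)(r(e)), so that p^(n)_(v,e) = a_(n+1)(r(e)) / a_n(v)
   is a Markov matrix, and the product of these quotients along a path
   telescopes to the mass of its last vertex. *)
Require Import Defs.
From HB Require Import structures.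
From mathcomp Require Import all_boot all_order all_algebra finmap.
From mathcomp Require Import all_classical all_reals all_analysis.
Import Order.TTheory GRing.Theory Num.Theory.
Local Open Scope classical_set_scope.
Local Open Scope ring_scope.

(** * Countable additivity over a countable index set *)

Lemma measure_countable_esum (d : measure_display) (X : measurableType d)
    (R : realType) (mu : {measure set X -> \bar R}) (T : choiceType)
    (D : set T) (F : T -> set X) :
  countable D -> (forall i, D i -> measurable (F i)) -> trivIset D F ->
  mu (\bigcup_(i in D) F i) = \esum_(i in D) mu (F i).
Proof.
move=> /countable_bijP[N]; rewrite card_eq_sym.
have [->|/set0P[t0 _]] := eqVneq D set0.
  by move=> *; rewrite bigcup_set0 measure0 esum_set0.
(* The bijection from a set [N] of naturals onto [D] is extracted as a total function, which needs a
   pointed codomain. *)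
pose m := isPointed.Build T t0.
pose T' : pointedType := HB.pack T m.
move=> /(@card_set_bijP _ T')[f bf] mF tF.
rewrite (reindex_esum N D f _ bf).
have fD i : N i -> D (f i) by case: bf => + _ _; exact.
have -> : \bigcup_(i in D) F i = \bigcup_(n in N) F (f n).
  apply/seteqP; split=> [x [i Di Fx]|x [n Nn Fx]]; last first.
    by exists (f n); [exact: fD|].
  by case: bf => _ _ /(_ i Di)[n Nn fn]; exists n; rewrite ?fn.
rewrite measure_bigcup; first by rewrite nneseries_esum// set_mem_set.
- by move=> n Nn; apply: mF; exact: fD.
- move=> i j Ni Nj [x [xi xj]]; case: bf => _ fi _.
  by apply: fi; rewrite ?inE//; apply: tF (fD _ Ni) (fD _ Nj) _; exists x.
Qed.

(** * Cylinders of finite paths and of vertices *)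

Section paths.
Variable B : gen_bratteli.

Lemma rng_surj n (v : vertex B) : exists e : edge B n, rng e = v.
Proof.
have [w fvw] := incidence_row_neq0 n v.
have [E0|/set0P[e [_ rev]]] := eqVneq (edges_between n w v) set0.
  by case: fvw; rewrite /incidence E0 fset_set0 cardfs0.
by exists e.
Qed.

(** Infinitely many edges may leave [v], but their ranges are countably many and each range is
    reached by finitely many of them. *)
Lemma countable_edges_from n (v : vertex B) :
  countable [set e : edge B n | src e = v].
Proof.
have -> : [set e : edge B n | src e = v] = \bigcup_w edges_between n v w.
  by apply/seteqP; split=> [e /= <-|e [w _ []]//]; exists (rng e).
apply: bigcup_countable => // w _.
by apply: finite_set_countable; exact: edges_finite.
Qed.

Definition next_edge n (v : vertex B) : edge B n := projT1 (cid (src_surj n v)).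

Lemma src_next_edge n v : src (next_edge n v) = v.
Proof. by rewrite /next_edge; case: cid. Qed.

(** Past its last edge, [f] is continued forever by [next_edge], since every vertex has an outgoing
    edge. *)
Lemma cylinder_neq0 n (f : fin_path B n) : cylinder f !=set0.
Proof.
pose z := fix z j : edge B j := match j with
  | 0 => f ord0
  | k.+1 => match pselect (k.+1 < n.+1)%N with
            | left H => f (Ordinal H)
            | right _ => next_edge k.+1 (rng (z k))
            end
  end.
have zE j (jn : (j < n.+1)%N) : z j = f (Ordinal jn).
  case: j jn => [|j] jn /=; first by rewrite (bool_irrelevance jn (ltn0Sn n)).
  by case: pselect => // H; rewrite (bool_irrelevance H jn).
have zP j : rng (z j) = src (z j.+1).
  have [jn|jn] := boolP (j.+1 < n.+1)%N.
    rewrite (zE _ jn) (zE _ (ltnW jn)).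
    have := fpath_edgeP f (Ordinal (jn : (j < n)%N)).
    rewrite /widen_ord /lift /=.
    set p := widen_ord_proof _ _; set q := lift_subproof _ _.
    by rewrite (bool_irrelevance p (ltnW jn)) (bool_irrelevance q jn).
  rewrite /=; case: pselect => [H|_]; first by rewrite H in jn.
  by rewrite src_next_edge.
exists (InfPath zP) => -[i ilt] /=; exact: zE.
Qed.

Lemma open_cylinder n (f : fin_path B n) : open (cylinder f).
Proof.
exists [set cylinder f]; last by rewrite bigcup_set1.
by move=> _ ->; exists n, f.
Qed.

Lemma cylinder_edge0 (e : edge B 0) : exists g : fin_path B 0,
  fpath_end g = rng e /\ cylinder g = [set x : path_space B | x 0 = e].
Proof.
have gP (i : 'I_0) :
    rng (eqtype.dfwith (path_edge point) e (widen_ord (leqnSn 0) i)) =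
    src (eqtype.dfwith (path_edge point) e (lift ord0 i)) by case: i.
exists (@FinPath B 0 (fun i => eqtype.dfwith (path_edge point) e i) gP); split.
  by rewrite /fpath_end /= (@dfwith_in _ (edge B) _ 0%N).
apply/seteqP; split=> [x /(_ ord0)|x xe [[|//] ?]] /=.
  by rewrite (@dfwith_in _ (edge B) _ 0%N).
by rewrite (@dfwith_in _ (edge B) _ 0%N).
Qed.

Lemma cylinder_rcons n (f : fin_path B n) (e : edge B n.+1) :
  src e = fpath_end f ->
  exists g : fin_path B n.+1, fpath_end g = rng e /\
    cylinder g = cylinder f `&` [set x : path_space B | x n.+1 = e].
Proof.
(* The longer path is the start of an infinite path through [f] with coordinate [n.+1] overwritten
   by [e]. *)
move=> ef; have [x xf] := cylinder_neq0 _ f.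
have gn : eqtype.dfwith (path_edge x) e n.+1 = e by rewrite dfwith_in.
have gl i : (i < n.+1)%N -> eqtype.dfwith (path_edge x) e i = x i.
  by move=> il; rewrite dfwith_out// gtn_eqF.
have gP (i : 'I_n.+1) :
    rng (eqtype.dfwith (path_edge x) e (widen_ord (leqnSn n.+1) i)) =
    src (eqtype.dfwith (path_edge x) e (lift ord0 i)).
  case: i => i il /=; rewrite gl// /bump leq0n add1n.
  have [->|ni] := eqVneq i n; last first.
    by rewrite gl ?path_edgeP// ltnS ltn_neqAle ni.
  by rewrite gn ef /fpath_end -xf.
exists (@FinPath B n.+1 (fun i => eqtype.dfwith (path_edge x) e i) gP).
split; first by rewrite /fpath_end /= gn.
apply/seteqP; split=> [y yg|y [yf ye] [i il]] /=.
  split=> [[i il]|] /=.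
    by have := yg (Ordinal (leqW il)); rewrite /= gl// (xf (Ordinal il)).
  by have := yg ord_max; rewrite /= gn.
move: il; rewrite ltnS leq_eqVlt => /orP[/eqP|] il.
  by rewrite il gn.
by rewrite gl// (xf (Ordinal il)) (yf (Ordinal il)).
Qed.

Lemma fin_path_to n (v : vertex B) : exists f : fin_path B n, fpath_end f = v.
Proof.
elim: n v => [|n IHn] v.
  have [e <-] := rng_surj 0 v.
  by have [g [ge _]] := cylinder_edge0 e; exists g.
have [e <-] := rng_surj n.+1 v; have [f fe] := IHn (src e).
by have [g [ge _]] := cylinder_rcons _ f e (esym fe); exists g.
Qed.

(* The cylinder of one chosen path from V_0 to [v] in V_n; there are no edges to
   choose when n = 0, and then it is the set of all paths starting at [v]. *)
Definition vertex_cylinder n (v : vertex B) : set (path_space B) :=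
  match n with
  | 0 => [set x | src (x 0) = v]
  | m.+1 => cylinder (projT1 (cid (fin_path_to m v)))
  end.

Lemma src_vertex_cylinder n v x : vertex_cylinder n v x -> src (x n) = v.
Proof.
case: n => [//|n] /=; case: cid => f /= <- /(_ ord_max) fx.
by rewrite -path_edgeP /fpath_end -fx.
Qed.

(** Cutting by the next edge gives a cylinder of a finite path at every level, 0 included, so tail
    invariance applies to the pieces. *)
Lemma vertex_cylinder_edge n v (e : edge B n) : src e = v ->
  exists g : fin_path B n, fpath_end g = rng e /\
    vertex_cylinder n v `&` [set x | x n = e] = cylinder g.
Proof.
case: n e => [|n] e ev /=.
  have [g [ge gE]] := cylinder_edge0 e; exists g; split=> //.
  by rewrite gE; apply/seteqP; split=> [x []//|x /= xe]; split; rewrite //= xe.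
case: cid => f /= fv.
have [|g [ge gE]] := cylinder_rcons _ f e; first by rewrite ev fv.
by exists g.
Qed.

Lemma vertex_cylinder_bigcup n v :
  vertex_cylinder n v = \bigcup_(e in [set e : edge B n | src e = v])
    (vertex_cylinder n v `&` [set x | x n = e]).
Proof.
apply/seteqP; split=> [x vx|x [e _ []]//].
by exists (x n) => //; exact: src_vertex_cylinder vx.
Qed.

Lemma open_vertex_cylinder n v : open (vertex_cylinder n v).
Proof.
rewrite vertex_cylinder_bigcup; apply: bigcup_open => e /= ev.
by have [g [_ ->]] := vertex_cylinder_edge _ _ _ ev; exact: open_cylinder.
Qed.

Lemma vertex_cylinder_neq0 n v : vertex_cylinder n v !=set0.
Proof.
have [e ev] := src_surj n v; have [g [_ gE]] := vertex_cylinder_edge _ _ _ ev.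
by have [x] := cylinder_neq0 _ g; rewrite -gE => -[vx _]; exists x.
Qed.

Lemma open_measurable_paths (U : set (path_space B)) :
  open U -> measurable (U : set (borel_path_space B)).
Proof. exact: sub_sigma_algebra. Qed.

Variables (R : realType).

Lemma measure_vertex_cylinder
    (mu : {measure set (borel_path_space B) -> \bar R}) n v :
  tail_invariant mu ->
  mu (vertex_cylinder n v) =
  \esum_(e in [set e : edge B n | src e = v]) mu (vertex_cylinder n.+1 (rng e)).
Proof.
move=> mut; rewrite vertex_cylinder_bigcup.
rewrite (measure_countable_esum _ (borel_path_space B)).
- apply: eq_esum => e /= ev; have [g [ge ->]] := vertex_cylinder_edge _ _ _ ev.
  (* The path [g] and the path chosen for [rng e] end at the same vertex. *)
  by apply: mut; case: cid => f /= ->.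
- exact: countable_edges_from.
- move=> e /= ev; have [g [ge ->]] := vertex_cylinder_edge _ _ _ ev.
  by apply: open_measurable_paths; exact: open_cylinder.
- by move=> e e' _ _ [x [[_ <-] [_ <-]]].
Qed.

End paths.

(** * Vertex masses and transition probabilities *)

Section transition.
Variables (R : realType) (B : gen_bratteli).
Variable nu : probability (borel_path_space B) R.
Hypothesis nu_tail : tail_invariant nu.

Definition vertex_mass n (v : vertex B) : R :=
  fine (nu (vertex_cylinder B n v)).

Lemma vertex_massE n v : nu (vertex_cylinder B n v) = (vertex_mass n v)%:E.
Proof.
rewrite /vertex_mass fineK// fin_num_measure//.
by apply: open_measurable_paths; exact: open_vertex_cylinder.
Qed.

Lemma vertex_mass_ge0 n v : 0 <= vertex_mass n v.
Proof. exact: fine_ge0. Qed.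

(** One term of a sum of non-negative terms is at most the sum. Hence a null vertex has only null
    successors. *)
Lemma vertex_mass_rng_le n (e : edge B n) :
  vertex_mass n.+1 (rng e) <= vertex_mass n (src e).
Proof.
rewrite -lee_fin -!vertex_massE (measure_vertex_cylinder _ _ nu n)//.
apply: esum_ge; exists [set e]; last by rewrite fsbig_set1.
by split; [exact: finite_set1|move=> _ ->].
Qed.

(* When [v] has mass 0 the quotient would be a row of zeros (as x / 0 = 0), so
   the row is replaced by a Dirac mass on some edge leaving [v]. *)
Definition transition n (v : vertex B) (e : edge B n) : R :=
  if src e != v then 0
  else if vertex_mass n v == 0 then (e == next_edge B n v)%:R
  else vertex_mass n.+1 (rng e) / vertex_mass n v.

Lemma transition_ge0 n v e : 0 <= transition n v e.
Proof.
rewrite /transition; do 2 case: ifP => //.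
by rewrite ?divr_ge0 ?vertex_mass_ge0.
Qed.

Lemma transition_src n v e : 0 < transition n v e -> src e = v.
Proof. by rewrite /transition; case: eqP => //; rewrite ltxx. Qed.

Lemma vertex_mass_transition n (e : edge B n) :
  vertex_mass n (src e) * transition n (src e) e = vertex_mass n.+1 (rng e).
Proof.
rewrite /transition eqxx /=; have [m0|m0] := eqVneq; last first.
  by rewrite mulrCA mulfV// mulr1.
(* From a source of mass 0 the range has mass 0 too, so the choice of the Dirac row does not
   matter. *)
rewrite m0 mul0r; apply/eqP.
by rewrite eq_le vertex_mass_ge0 -m0 vertex_mass_rng_le.
Qed.

Lemma esum_transition n v :
  \esum_(e in [set e | src e = v]) (transition n v e)%:E = 1%E.
Proof.
have [m0|m0] := eqVneq (vertex_mass n v) 0.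
  (* For the Dirac row, 1 is written as a sum over one edge, then extended by zeros to all edges
     leaving [v]. *)
  rewrite -[RHS](@esum_set1 R _ (next_edge B n v) (fun=> 1%E))//.
  rewrite -(setIidr (_ : [set next_edge B n v] `<=` [set e | src e = v])).
    rewrite esum_mkcondr; apply: eq_esum => e /= ev.
    rewrite /transition ev eqxx m0 eqxx /=.
    rewrite (_ : (e \in _) = (e == next_edge B n v)).
      by case: eqP.
    by apply/idP/eqP; rewrite inE.
  by move=> _ ->; exact: src_next_edge.
have m_ge0 : 0 <= (vertex_mass n v)^-1 by rewrite invr_ge0 vertex_mass_ge0.
(* The rescaled measure turns countable additivity of [nu] into the row sum. *)
pose mu : {measure set (borel_path_space B) -> \bar R} :=
  mscale (NngNum m_ge0) nu.
have mu_tail : tail_invariant mu.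
  by move=> k f f' ff'; rewrite /mu /= /mscale (nu_tail _ _ _ ff').
have muE k w : mu (vertex_cylinder B k w) =
    ((vertex_mass n v)^-1 * vertex_mass k w)%:E.
  by rewrite EFinM -vertex_massE.
have := measure_vertex_cylinder _ _ mu n v mu_tail.
rewrite muE mulVf// => ->; apply: eq_esum => e ev.
by rewrite muE /transition ev eqxx (negPf m0) /= mulrC.
Qed.

Lemma transition_markov n : weak_markov_matrix (transition n).
Proof.
split; [exact: transition_ge0|exact: transition_src|exact: esum_transition].
Qed.

Lemma measure_cylinder n (f : fin_path B n) :
  nu (cylinder f) = (vertex_mass n.+1 (fpath_end f))%:E.
Proof.
by rewrite -vertex_massE; apply: nu_tail => /=; case: cid => g /= ->.
Qed.

(** Along an infinite path the terminal vertex is [src (x n)], which also covers the empty product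
    at [n = 0]. *)
Lemma path_transition_prod (x : path_space B) n :
  vertex_mass 0 (src (x 0)) * \prod_(i < n) transition i (src (x i)) (x i) =
  vertex_mass n (src (x n)).
Proof.
elim: n => [|n IHn]; first by rewrite big_ord0 mulr1.
by rewrite big_ord_recr mulrA /= IHn vertex_mass_transition path_edgeP.
Qed.

Lemma transition_is_markov_measure :
  is_markov_measure (vertex_mass 0) transition nu.
Proof.
move=> n f; have [x xf] := cylinder_neq0 _ _ f.
rewrite [LHS]measure_cylinder /fpath_start /fpath_end -!xf path_edgeP.
rewrite -path_transition_prod; congr (_ * _)%:E.
by apply: eq_bigr => i _; rewrite xf.
Qed.

Lemma vertex_mass_gt0 n v : full_support nu -> 0 < vertex_mass n v.
Proof.
move=> nuf; rewrite -lte_fin -vertex_massE nuf//.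
  exact: open_vertex_cylinder.
exact: vertex_cylinder_neq0.
Qed.

End transition.

Theorem theorem3p8 (R : realType) (B : gen_bratteli)
    (nu : probability (borel_path_space B) R) (nu_tail : tail_invariant nu) :
  exists (q : vertex B -> R) (P : forall n, vertex B -> edge B n -> R),
    [/\ forall v, 0 <= q v,
        forall n, weak_markov_matrix (P n),
        is_markov_measure q P nu &
        full_support nu ->
          (forall v, 0 < q v) /\ (forall n, markov_matrix (P n))].
Proof.
exists (vertex_mass R B nu 0), (transition R B nu); split.
- exact: vertex_mass_ge0.
- exact: transition_markov.
- exact: transition_is_markov_measure.
(* Vertex cylinders are open and non-empty, so full support excludes the Dirac rows and makes all
   the quotients positive. *)
move=> nuf; have mass_gt0 n v := vertex_mass_gt0 _ _ nu n v nuf.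
split=> [//|n]; have [P0 Psrc P1] := transition_markov _ _ nu nu_tail n.
split=> // v e; split=> [|<-]; first exact: Psrc.
by rewrite /transition eqxx gt_eqF//= divr_gt0.
Qed.
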